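(* Let $r\ge1$. There exists a constant $C_r$ such that the following holds. Let $n\ge 3r$, $\lambda\vdash n$ with $n-\lambda_1=r$, and $\sigma\in\mathfrak{S}_n$ with $f:=f_1(\sigma)\ge 2r$; let $\alpha$ be the cycle lengths of $\sigma$ listed in weakly increasing order. Let $\mu\vdash f$ with $\mu\subset\lambda$, let $K=|\lambda^*\setminus\mu^*|$ and assume $K\ge2$. Let $s=(s_i)_{i\ge2}$ be nonnegative integers with $\sum_{i\ge2} i s_i=K$. Let $S(\lambda,\alpha,\mu,s)$ be the set of ribbon tableaux of shape $\lambda$ and weight $\alpha$ in which the ribbons of length $1$ fill exactly the cells of $\mu$, and the cells of $\lambda^*\setminus\mu^*$ are covered by exactly $s_i$ ribbons of length $i$ for each $i\ge2$. Then $$|S(\lambda,\alpha,\mu,s)|\le C_r\, f^{r-K}\,G(\sigma)^K\le C_r\,M(\sigma)^r.$$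
   Context: A ribbon (rim hook) is a connected skew Young diagram containing no $2\times2$ square; its height is its number of rows minus one. A ribbon tableau of shape $\lambda\vdash n$ and weight $\alpha=(\alpha_1,\dots,\alpha_p)$ (a sequence of positive integers summing to $n$) is a chain of Young diagrams $\emptyset=\lambda^{(0)}\subset\lambda^{(1)}\subset\cdots\subset\lambda^{(p)}=\lambda$ such that each $\lambda^{(i)}\setminus\lambda^{(i-1)}$ is a ribbon with $\alpha_i$ cells; its height is the sum of the heights of its ribbons. $\lambda_1$ is the first row length of $\lambda$ and $\lambda^*=(\lambda_2,\lambda_3,\dots)$; for $\mu\subset\lambda$, $\lambda^*\setminus\mu^*$ is the set of cells of $\lambda\setminus\mu$ not in the first row. $f_i(\sigma)$ is the number of $i$-cycles of $\sigma$, $M(\sigma)=\max_{i\ge1}f_i(\sigma)^{1/i}$ and $G(\sigma)=\max_{i\ge2}f_i(\sigma)^{1/i}$. *)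

(* Defs.v *)
From HB Require Import structures.
From mathcomp Require Import all_boot all_order all_algebra all_fingroup.
From mathcomp Require Import boolp reals exp.
Set Implicit Arguments. Unset Strict Implicit. Unset Printing Implicit Defensive.
Import Order.TTheory GRing.Theory Num.Theory.

Definition is_partition (n : nat) (lam : seq nat) : bool :=
  [&& sorted geq lam, all (fun x => 0 < x) lam & sumn lam == n].

Definition subpart (mu lam : seq nat) : bool :=
  all (fun i => nth 0 mu i <= nth 0 lam i) (iota 0 (size mu)).

Section Cells.
Variable n : nat.
Definition cell := ('I_n * 'I_n)%type.

(* Young diagram of lam, cells (row, column), 0-indexed. *)
Definition diagram (lam : seq nat) : {set cell} :=
  [set c : cell | (c.2 : nat) < nth 0 lam c.1].

Definition inD (D : {set cell}) (i j : nat) : bool :=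
  [exists c in D, ((c.1 : nat) == i) && ((c.2 : nat) == j)].

Definition is_young (D : {set cell}) : bool :=
  [forall c in D, forall d : cell,
     ((d.1 <= c.1) && (d.2 <= c.2))%N ==> (d \in D)].

Definition adjacent (a b : cell) : bool :=
  (((a.1 : nat) == b.1) && (((a.2 : nat) == b.2.+1) || ((b.2 : nat) == a.2.+1)))
  || (((a.2 : nat) == b.2) && (((a.1 : nat) == b.1.+1) || ((b.1 : nat) == a.1.+1))).

Definition connected_cells (D : {set cell}) : bool :=
  (D != set0) &&
  [forall x in D, forall y in D,
     connect (fun a b => [&& a \in D, b \in D & adjacent a b]) x y].

Definition no_square (D : {set cell}) : bool :=
  [forall c in D, ~~ [&& inD D c.1 c.2.+1, inD D c.1.+1 c.2 & inD D c.1.+1 c.2.+1]].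

Definition is_ribbon (D : {set cell}) : bool := connected_cells D && no_square D.

Definition ribbon_of (p : nat) (T : {ffun 'I_p.+1 -> {set cell}}) (i : nat)
  : {set cell} := T (inord i.+1) :\: T (inord i).

Definition is_ribbon_tableau (lam al : seq nat)
  (T : {ffun 'I_(size al).+1 -> {set cell}}) : bool :=
  [&& T ord0 == set0, T ord_max == diagram lam,
      [forall i : 'I_(size al).+1, is_young (T i)] &
      [forall i : 'I_(size al),
         [&& T (inord i) \subset T (inord i.+1),
             is_ribbon (ribbon_of T i) &
             #|ribbon_of T i| == nth 0 al i]]].

(* cells of lam^* \ mu^*: cells of lam \ mu not in the first row *)
Definition lower_skew (lam mu : seq nat) : {set cell} :=
  [set c in diagram lam :\: diagram mu | (c.1 : nat) != 0].

Definition S_set (lam al mu : seq nat) (s : nat -> nat)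
  : {set {ffun 'I_(size al).+1 -> {set cell}}} :=
  [set T | [&& @is_ribbon_tableau lam al T,
     (\bigcup_(i < size al | nth 0 al i == 1%N) ribbon_of T i) == diagram mu &
     `[< forall i : nat, (2 <= i)%N ->
        #|[set j : 'I_(size al) | (nth 0 al j == i) &&
              (ribbon_of T j :&: lower_skew lam mu != set0)]| = s i >]]].
End Cells.

Definition fcyc (n : nat) (sigma : {perm 'I_n}) (i : nat) : nat :=
  #|[set c in porbits sigma | #|c| == i]|.

Definition cycle_type_inc (n : nat) (sigma : {perm 'I_n}) : seq nat :=
  sort leq [seq #|pred_of_set c| | c : {set 'I_n} <- enum (porbits sigma)].

Local Open Scope ring_scope.
(* M(sigma) = max_{i>=1} f_i^{1/i}, G(sigma) = max_{i>=2} f_i^{1/i};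
   f_i = 0 for i > n, and all terms are >= 0, so the max over 1..n (resp. 2..n)
   with default 0 is the same. *)
Definition Mstat (R : realType) (n : nat) (sigma : {perm 'I_n}) : R :=
  \big[Num.max/0]_(1 <= i < n.+1) ((fcyc sigma i)%:R `^ (i%:R)^-1).
Definition Gstat (R : realType) (n : nat) (sigma : {perm 'I_n}) : R :=
  \big[Num.max/0]_(2 <= i < n.+1) ((fcyc sigma i)%:R `^ (i%:R)^-1).

(* Main.v *)
Require Import Defs.
From HB Require Import structures.
From mathcomp Require Import all_boot all_order all_algebra all_fingroup.
From mathcomp Require Import boolp reals exp.
From mathcomp Require Import zify ring.
Import Order.TTheory GRing.Theory Num.Theory.

Set Implicit Arguments.
Unset Strict Implicit.
Unset Printing Implicit Defensive.

(* Every shape of a ribbon tableau is a Young diagram, so it is determined by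
   its cells outside the first row and by its size, a partial sum of the
   weight.  Hence a tableau is determined by the index of the ribbon covering
   each of the r cells of lambda below the first row.  The r - K such cells of
   mu lie in ribbons of length 1, leaving at most f choices each.  The K cells
   of lambda^* \ mu^* lie in the set W of ribbons of length >= 2 meeting them;
   W consists of s_i of the f_i ribbons of length i, so there are at most
   prod_i binom(f_i, s_i) <= prod_i (G^i)^(s_i) = G^K choices for W, and then at
   most |W|^K <= K^K <= r^r ways to place the K cells.  Thus C_r = r^r works,
   and the second inequality follows from f <= M and G <= M. *)

Lemma card_ord_ltn n m : #|[set j : 'I_n | j < m]| = minn m n.
Proof.
rewrite -sum1dep_card; elim: n => [|n IH]; first by rewrite big_ord0 minn0.
rewrite big_mkcond big_ord_recr /= -big_mkcond IH.
by case: ltnP => h; lia.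
Qed.

Lemma nth_le_sumn (s : seq nat) i : nth 0 s i <= sumn s.
Proof. by elim: s i => [|x s IH] [|i] //=; [lia | have := IH i; lia]. Qed.

Lemma size_le_sumn (s : seq nat) : all (fun x => 0 < x) s -> size s <= sumn s.
Proof. by elim: s => [|x s IH] //= /andP[x_gt0 /IH]; lia. Qed.

Lemma sum_nth_ord (s : seq nat) n :
  size s <= n -> \sum_(i < n) nth 0 s i = sumn s.
Proof.
rewrite -(big_mkord xpredT (nth 0 s)).
elim: s n => [|x s IH] n; first by rewrite big1_seq // => i; rewrite nth_nil.
by case: n => [|n] //= le_s_n; rewrite big_nat_recl //= -(IH n).
Qed.

Lemma bin_le_expn n m : 'C(n, m) <= n ^ m.
Proof.
apply: leq_trans (leq_pmulr _ (fact_gt0 m)) _.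
rewrite bin_ffact ffact_prod.
have -> : n ^ m = \prod_(i < m) n by rewrite prod_nat_const card_ord.
by apply: leq_prod => i _; apply: leq_subr.
Qed.

Lemma leq_expn2r m1 m2 e : m1 <= m2 -> m1 ^ e <= m2 ^ e.
Proof. by move=> le_m; elim: e => [|e IH]; rewrite ?expn0 // !expnS leq_mul. Qed.

Lemma leq_card_bigcup (I T : finType) (P : pred I) (F : I -> {set T}) :
  #|\bigcup_(i | P i) F i| <= \sum_(i | P i) #|F i|.
Proof.
apply: (big_rec2 (fun (X : {set T}) m => #|X| <= m)); first by rewrite cards0.
by move=> i X m _ le_X; rewrite cardsU; lia.
Qed.

Lemma count_enum_card (T : finType) (A : {pred T}) (P : pred T) :
  count P (enum A) = #|[set x in A | P x]|.
Proof.
rewrite -sum1_count big_enum_cond -sum1_card.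
by apply: eq_bigl => x; rewrite !inE.
Qed.

Lemma card_cells_lt n (g : nat -> nat) (P : pred nat) :
  #|[set c : cell n | P c.1 && (c.2 < g c.1)]| = \sum_(i < n | P i) minn (g i) n.
Proof.
rewrite -sum1dep_card.
rewrite -(pair_big_dep (fun i : 'I_n => P i) (fun i j : 'I_n => j < g i) (fun _ _ => 1)) /=.
by apply: eq_bigr => i _; rewrite sum1dep_card card_ord_ltn.
Qed.

Section YoungDiagram.
Variable n : nat.

Definition off_row0 : {set cell n} := [set c : cell n | c.1 != 0 :> nat].

Lemma mem_young_le (D : {set cell n}) (c d : cell n) :
  is_young D -> c \in D -> d.1 <= c.1 -> d.2 <= c.2 -> d \in D.
Proof.
move=> /forallP /(_ c) young_D cD le1 le2.
by move: young_D; rewrite cD /= => /forallP /(_ d); rewrite le1 le2.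
Qed.

Lemma card_row (a : 'I_n) (P : pred 'I_n) :
  #|[set d : cell n | (d.1 == a) && P d.2]| = #|[set j | P j]|.
Proof.
transitivity #|[set (a, j) | j in [set j | P j]]|; last first.
  by apply: card_imset => x y [].
apply: eq_card => -[x y]; rewrite !inE /=.
apply/andP/imsetP => [[/eqP -> Py] | [j]]; first by exists y; rewrite ?inE.
by rewrite inE => Pj [-> ->]; rewrite eqxx.
Qed.

Lemma young_row0E (D : {set cell n}) (c : cell n) : is_young D ->
  c.1 = 0 :> nat -> (c \in D) = (c.2 < #|D :\: off_row0|).
Proof.
move=> young_D c0.
have row0_eq d : d \in D :\: off_row0 = (d.1 == c.1) && (d \in D).
  by rewrite !inE negbK -c0 (inj_eq val_inj).
apply/idP/idP => [cD | ].
  have : [set d : cell n | (d.1 == c.1) && (d.2 < c.2.+1)] \subset D :\: off_row0.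
    apply/subsetP => d; rewrite inE row0_eq => /andP[/eqP d1 ltd2]; rewrite d1 eqxx.
    by apply: mem_young_le young_D cD _ _; rewrite ?d1.
  move/subset_leq_card; rewrite (card_row c.1 (fun j => j < c.2.+1)) card_ord_ltn.
  by move/(leq_trans _); apply; rewrite leq_min leqnn ltn_ord.
apply: contraLR => cD; rewrite -leqNgt.
have : D :\: off_row0 \subset [set d : cell n | (d.1 == c.1) && (d.2 < c.2)].
  apply/subsetP => d; rewrite row0_eq inE => /andP[d1 dD]; rewrite d1 /= ltnNge.
  by apply: contra cD => le2; apply: mem_young_le young_D dD _ le2; rewrite (eqP d1).
move/subset_leq_card; rewrite (card_row c.1 (fun j => j < c.2)) card_ord_ltn.
by move/leq_trans; apply; apply: geq_minl.
Qed.

Lemma young_eq_off_row0 (D D' : {set cell n}) : is_young D -> is_young D' ->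
  D :&: off_row0 = D' :&: off_row0 -> #|D| = #|D'| -> D = D'.
Proof.
move=> young_D young_D' eq_off eq_card.
have eq_row0 : #|D :\: off_row0| = #|D' :\: off_row0|.
  by move: eq_card; rewrite -(cardsID off_row0 D) -(cardsID off_row0 D') eq_off; lia.
apply/setP => c; case: (boolP (c \in off_row0)) => c_off.
  by move/setP: eq_off => /(_ c); rewrite !in_setI c_off !andbT.
have c0 : c.1 = 0 :> nat by move: c_off; rewrite inE negbK => /eqP.
by rewrite (young_row0E young_D c0) (young_row0E young_D' c0) eq_row0.
Qed.

End YoungDiagram.

Section RibbonTableau.
Variables (n : nat) (lam al : seq nat).
Local Notation p := (size al).
Implicit Types (T : {ffun 'I_p.+1 -> {set cell n}}) (c : cell n).

Lemma tab0 T : is_ribbon_tableau lam T -> T ord0 = set0.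
Proof. by case/and4P => /eqP. Qed.

Lemma tab_max T : is_ribbon_tableau lam T -> T ord_max = diagram n lam.
Proof. by case/and4P => _ /eqP. Qed.

Lemma tab_young T i : is_ribbon_tableau lam T -> is_young (T i).
Proof. by case/and4P => _ _ /forallP. Qed.

Lemma tab_subS T (k : 'I_p) : is_ribbon_tableau lam T ->
  T (inord k) \subset T (inord k.+1).
Proof. by case/and4P => _ _ _ /forallP /(_ k) /and3P[]. Qed.

Lemma card_ribbon_of T (k : 'I_p) : is_ribbon_tableau lam T ->
  #|ribbon_of T k| = nth 0 al k.
Proof. by case/and4P => _ _ _ /forallP /(_ k) /and3P[_ _ /eqP]. Qed.

Lemma tab_sub T (i j : 'I_p.+1) : is_ribbon_tableau lam T ->
  i <= j -> T i \subset T j.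
Proof.
move=> tabT le_ij; rewrite -(inord_val j).
have : (j <= p)%N by rewrite -ltnS.
elim: (val j) le_ij => [|k IH] le_ik le_kp.
  by rewrite leqn0 in le_ik; rewrite -(inord_val i) (eqP le_ik).
case: (ltnP i k.+1) => [lt_ik | ge_ik].
  exact: subset_trans (IH lt_ik (ltnW le_kp)) (tab_subS (Ordinal le_kp) tabT).
by rewrite -(inord_val i) (_ : i = k.+1 :> nat) ?subxx //; lia.
Qed.

Lemma tab_sub_diagram T i c : is_ribbon_tableau lam T ->
  c \in T i -> c \in diagram n lam.
Proof.
move=> tabT; rewrite -(tab_max tabT); apply: (subsetP (tab_sub tabT _)).
by rewrite -ltnS.
Qed.

(* The shapes increase, so the number of shapes missing [c] is the first index
   [i] with [c \in T i], i.e. one more than the index of the ribbon of [c]. *)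
Definition tab_label T c := #|[set i : 'I_p.+1 | c \notin T i]|.

Lemma mem_tab T c i : is_ribbon_tableau lam T -> (c \in T i) = (tab_label T c <= i).
Proof.
move=> tabT; apply/idP/idP => [ci | ].
  apply: leq_trans (subset_leq_card (_ : _ \subset [set k : 'I_p.+1 | k < i])) _.
    apply/subsetP => k; rewrite !inE ltnNge; apply: contra => le_ik.
    exact: subsetP (tab_sub tabT le_ik) c ci.
  by rewrite card_ord_ltn geq_minl.
apply: contraLR; rewrite -ltnNge => ci.
have : [set k : 'I_p.+1 | k < i.+1] \subset [set k | c \notin T k].
  apply/subsetP => k; rewrite !inE ltnS => le_ki; apply: contra ci => ck.
  exact: subsetP (tab_sub tabT le_ki) c ck.
move/subset_leq_card; rewrite card_ord_ltn.
by move/(leq_trans _); apply; rewrite leq_min leqnn ltn_ord.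
Qed.

Lemma tab_label_gt0 T c : is_ribbon_tableau lam T -> 0 < tab_label T c.
Proof. by move=> tabT; have := mem_tab c ord0 tabT; rewrite (tab0 tabT) inE; lia. Qed.

Lemma tab_label_le T c : is_ribbon_tableau lam T ->
  c \in diagram n lam -> tab_label T c <= p.
Proof. by move=> tabT; rewrite -(tab_max tabT) (mem_tab _ _ tabT). Qed.

Lemma mem_ribbon_of T c j : is_ribbon_tableau lam T -> j < p ->
  (c \in ribbon_of T j) = (tab_label T c == j.+1).
Proof.
move=> tabT lt_jp; have lt_j1 : j < p.+1 by lia.
by rewrite /ribbon_of !inE !(mem_tab _ _ tabT) !inordK // -ltnNge eqn_leq andbC.
Qed.

Lemma card_tab T k : is_ribbon_tableau lam T -> k <= p ->
  #|T (inord k)| = \sum_(j < k) nth 0 al j.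
Proof.
move=> tabT; elim: k => [|k IH] le_kp.
  rewrite (_ : inord 0 = ord0) ?(tab0 tabT) ?cards0 ?big_ord0 //.
  by apply: val_inj; rewrite /= inordK.
rewrite big_ord_recr /= -IH ?(ltnW le_kp) //.
have sub_k := tab_subS (Ordinal le_kp) tabT.
rewrite -(card_ribbon_of (Ordinal le_kp) tabT) /ribbon_of /= cardsD (setIidPr sub_k).
by rewrite subnKC // subset_leq_card.
Qed.

Lemma tab_label_pred_lt T c : is_ribbon_tableau lam T ->
  c \in diagram n lam -> (tab_label T c).-1 < p.
Proof. by move=> tabT /(tab_label_le tabT); have := tab_label_gt0 c tabT; lia. Qed.

Lemma mem_ribbon_of_label T c : is_ribbon_tableau lam T ->
  c \in diagram n lam -> c \in ribbon_of T (tab_label T c).-1.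
Proof.
move=> tabT c_lam; rewrite mem_ribbon_of ?(tab_label_pred_lt tabT) //.
by have := tab_label_gt0 c tabT; lia.
Qed.

Definition lower_diagram : {set cell n} := diagram n lam :&: off_row0 n.

(* [ord0] is a junk value on the cells of the first row and outside [lam]. *)
Definition ribbon_index T : {ffun cell n -> 'I_p.+1} :=
  [ffun c => if c \in lower_diagram then inord (tab_label T c).-1 else ord0].

Lemma ribbon_indexE T c : is_ribbon_tableau lam T -> c \in lower_diagram ->
  ribbon_index T c = (tab_label T c).-1 :> nat.
Proof.
move=> tabT c_low; rewrite ffunE c_low inordK //.
by move: c_low; rewrite inE => /andP[/(tab_label_le tabT)]; lia.
Qed.

Lemma ribbon_index_inj T T' : is_ribbon_tableau lam T -> is_ribbon_tableau lam T' ->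
  ribbon_index T = ribbon_index T' -> T = T'.
Proof.
move=> tabT tabT' eq_index.
have eq_label c : c \in lower_diagram -> tab_label T c = tab_label T' c.
  move=> c_low; have : ribbon_index T c = ribbon_index T' c :> nat by rewrite eq_index.
  rewrite (ribbon_indexE tabT c_low) (ribbon_indexE tabT' c_low).
  by have := tab_label_gt0 c tabT; have := tab_label_gt0 c tabT'; lia.
apply/ffunP => i.
apply: young_eq_off_row0; rewrite ?(tab_young _ tabT) ?(tab_young _ tabT') //.
  apply/setP => c; rewrite !in_setI; case c_off: (c \in off_row0 n); rewrite ?andbF // !andbT.
  case c_lam: (c \in diagram n lam).
    have c_low : c \in lower_diagram by rewrite inE c_lam c_off.
    by rewrite !(mem_tab _ _ tabT) !(mem_tab _ _ tabT') eq_label.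
  by apply/idP/idP => [/(tab_sub_diagram tabT) | /(tab_sub_diagram tabT')]; rewrite c_lam.
by rewrite -(inord_val i) !card_tab // -ltnS.
Qed.

Variables (mu : seq nat) (s : nat -> nat).
Local Notation skew := (lower_skew n lam mu).

Definition lower_mu : {set cell n} := lower_diagram :&: diagram n mu.

Definition ribbons_len i : {set 'I_p.+1} := [set x : 'I_p.+1 | nth 0 al x == i].

Definition skew_ribbons T : {set 'I_p.+1} :=
  [set x : 'I_p.+1 | (2 <= nth 0 al x) && (ribbon_of T x :&: skew != set0)].

Definition index_range (W : {set 'I_p.+1}) c : {set 'I_p.+1} :=
  if c \in lower_mu then ribbons_len 1 else if c \in skew then W else [set ord0].

Lemma lower_skewE : skew = lower_diagram :\: diagram n mu.
Proof. by apply/setP => c; rewrite !inE andbA. Qed.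

Lemma skew_notin_lower_mu c : c \in skew -> c \notin lower_mu.
Proof. by rewrite lower_skewE !inE => /andP[/negbTE ->]; rewrite andbF. Qed.

Lemma ribbon_index_in_family T : T \in S_set n lam al mu s ->
  ribbon_index T \in family (index_range (skew_ribbons T)).
Proof.
rewrite inE => /and3P[tabT /eqP cover_mu _]; apply/familyP => c; rewrite /index_range.
case: ifP => [/setIP[c_low c_mu] | c_nmu].
  move: c_mu; rewrite -cover_mu => /bigcupP[j /eqP len_j].
  rewrite (mem_ribbon_of c tabT (ltn_ord j)) => /eqP label_c.
  by rewrite inE (ribbon_indexE tabT c_low) label_c len_j.
case: ifP => [c_skew | c_nskew].
  have c_low : c \in lower_diagram by move: c_skew; rewrite lower_skewE => /setDP[].
  have c_lam : c \in diagram n lam by case/setIP: c_low.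
  have lt_jp := tab_label_pred_lt tabT c_lam.
  have c_j := mem_ribbon_of_label tabT c_lam.
  rewrite inE (ribbon_indexE tabT c_low); apply/andP; split; last first.
    by apply/set0Pn; exists c; rewrite inE c_j c_skew.
  have : 0 < nth 0 al (tab_label T c).-1.
    by rewrite -(card_ribbon_of (Ordinal lt_jp) tabT); apply/card_gt0P; exists c.
  suff : nth 0 al (tab_label T c).-1 != 1 by lia.
  apply: contraTneq c_skew => len_1; rewrite lower_skewE inE negb_and negbK.
  rewrite -cover_mu; apply/orP; left.
  by apply/bigcupP; exists (Ordinal lt_jp); rewrite /= ?len_1.
have c_nlow : c \notin lower_diagram.
  apply/negP => c_low; move: c_nmu c_nskew.
  by rewrite lower_skewE in_setD in_setI c_low /= => ->.
by rewrite ffunE (negbTE c_nlow) inE.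
Qed.

(* Ribbon indices live in ['I_p.+1]; the extra index [p] has [nth 0 al p = 0]. *)
Lemma card_nth_eq_widen i (Q : pred nat) : i != 0 ->
  #|[set x : 'I_p.+1 | (nth 0 al x == i) && Q x]| =
  #|[set j : 'I_p | (nth 0 al j == i) && Q j]|.
Proof.
move=> i_neq0.
have widen_inj : injective (widen_ord (leqnSn p)) by move=> x y /(congr1 val) /= /val_inj.
rewrite -(card_imset _ widen_inj); apply: eq_card => x; rewrite !inE.
apply/idP/imsetP => [/andP[len_x Qx] | [j]]; last by rewrite inE => Pj ->.
have lt_xp : x < p.
  by rewrite ltnNge; apply: contra i_neq0 => le_px; rewrite -(eqP len_x) nth_default.
by exists (Ordinal lt_xp); rewrite ?inE ?len_x //; apply: val_inj.
Qed.

Definition admissible_sets K : {set {set 'I_p.+1}} :=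
  [set W | [forall i : 'I_K.+1, (2 <= i) ==> (#|W :&: ribbons_len i| == s i)] &&
           (W \subset \bigcup_(i : 'I_K.+1 | 2 <= i) ribbons_len i)].

Lemma skew_ribbons_admissible T : T \in S_set n lam al mu s ->
  (forall i, #|skew| < i -> s i = 0) -> skew_ribbons T \in admissible_sets #|skew|.
Proof.
rewrite inE => /and3P[tabT _ /asboolP card_s] s_eq0.
rewrite inE; apply/andP; split.
  apply/forallP => i; apply/implyP => le_2i.
  rewrite -(card_s i le_2i) -(card_nth_eq_widen (fun j => ribbon_of T j :&: skew != set0)).
    apply/eqP; apply: eq_card => x; rewrite !inE.
    by case: (eqVneq (nth 0 al x) i) => [-> | _]; rewrite ?le_2i ?andbT ?andbF.
  by rewrite -lt0n; apply: leq_trans le_2i.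
apply/subsetP => x; rewrite inE => /andP[le_2x meet_x].
have le_xK : nth 0 al x <= #|skew|.
  rewrite leqNgt; apply/negP => /s_eq0 s_x0.
  have lt_xp : x < p by rewrite ltnNge; apply: contraTN le_2x => le_px; rewrite nth_default.
  move: (card_s _ le_2x); rewrite s_x0 => /eqP.
  rewrite cards_eq0 => /eqP /setP /(_ (Ordinal lt_xp)).
  by rewrite !inE /= eqxx meet_x.
by apply/bigcupP; exists (inord (nth 0 al x)); rewrite ?inE inordK.
Qed.

Lemma card_family_index_range W :
  #|family (index_range W)| = #|ribbons_len 1| ^ #|lower_mu| * #|W| ^ #|skew|.
Proof.
rewrite card_family foldrE big_map big_enum /= (bigID [in lower_mu]) /=.
congr (_ * _).
  by rewrite -prod_nat_const; apply: eq_bigr => c c_mu; rewrite /index_range c_mu.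
rewrite (bigID [in skew]) /= [X in _ * X]big1 ?muln1; last first.
  by move=> c /andP[/negbTE c_nmu /negbTE c_nskew]; rewrite /index_range c_nmu c_nskew cards1.
rewrite -prod_nat_const; apply: eq_big => c.
  by case: (boolP (c \in skew)) => [/skew_notin_lower_mu -> | _]; rewrite ?andbF.
by move=> /andP[/negbTE c_nmu c_skew]; rewrite /index_range c_nmu c_skew.
Qed.

Lemma card_admissible_le K W : W \in admissible_sets K ->
  \sum_(2 <= i < K.+1) i * s i = K -> #|W| <= K.
Proof.
rewrite inE => /andP[/forallP card_W sub_W] sum_s.
have : W \subset \bigcup_(i : 'I_K.+1 | 2 <= i) (W :&: ribbons_len i).
  apply/subsetP => x xW; have /bigcupP[i le_2i x_i] := subsetP sub_W x xW.
  by apply/bigcupP; exists i; rewrite // inE xW.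
move/subset_leq_card/leq_trans; apply; apply: leq_trans (leq_card_bigcup _ _) _.
rewrite -[X in _ <= X]sum_s big_geq_mkord /=.
apply: leq_sum => i le_2i; rewrite (eqP (implyP (card_W i) le_2i)).
by apply: leq_pmull; apply: leq_trans le_2i.
Qed.

Lemma card_admissible_sets K :
  #|admissible_sets K| <= \prod_(i < K.+1 | 2 <= i) 'C(#|ribbons_len i|, s i).
Proof.
pose parts W : {ffun 'I_K.+1 -> {set 'I_p.+1}} :=
  [ffun i : 'I_K.+1 => if 2 <= i then W :&: ribbons_len i else set0].
pose draws (i : 'I_K.+1) : {set {set 'I_p.+1}} :=
  if 2 <= i then [set V : {set 'I_p.+1} | V \subset ribbons_len i & #|V| == s i]
  else [set set0].
have parts_inj : {in admissible_sets K &, injective parts}.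
  move=> W W' W_adm W'_adm eq_parts; apply/setP => x.
  suff memE V : V \in admissible_sets K ->
      (x \in V) = [exists i : 'I_K.+1, (2 <= i) && (x \in parts V i)].
    by rewrite (memE W W_adm) (memE W' W'_adm) eq_parts.
  rewrite inE => /andP[_ sub_V]; apply/idP/existsP => [xV | [i /andP[le_2i]]].
    have /bigcupP[i le_2i x_i] := subsetP sub_V x xV.
    by exists i; rewrite le_2i ffunE le_2i inE xV x_i.
  by rewrite ffunE le_2i inE => /andP[].
rewrite -(card_in_imset parts_inj).
apply: leq_trans (subset_leq_card (_ : _ \subset [set h in family draws])) _.
  apply/subsetP => _ /imsetP[W W_adm ->]; rewrite inE; apply/familyP => i.
  rewrite /draws ffunE; case: ifP => le_2i; last by rewrite inE.
  move: W_adm; rewrite inE => /andP[/forallP card_W _].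
  by rewrite inE subsetIr (implyP (card_W i) le_2i).
rewrite cardsE card_family foldrE big_map big_enum /= [X in _ <= X]big_mkcond /=.
apply: eq_leq; apply: eq_bigr => i _.
by rewrite /draws; case: ifP => _; rewrite ?cards_draws ?cards1.
Qed.

Lemma card_S_set_le :
  (forall i, #|skew| < i -> s i = 0) ->
  \sum_(2 <= i < #|skew|.+1) i * s i = #|skew| ->
  #|S_set n lam al mu s| <=
    #|admissible_sets #|skew| | * (#|ribbons_len 1| ^ #|lower_mu| * #|skew| ^ #|skew|).
Proof.
move=> s_eq0 sum_s.
have index_inj : {in S_set n lam al mu s &, injective ribbon_index}.
  by move=> T T'; rewrite !inE => /and3P[tabT _ _] /and3P[tabT' _ _]; apply: ribbon_index_inj.
rewrite -(card_in_imset index_inj).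
apply: leq_trans (subset_leq_card (_ : _ \subset
  \bigcup_(W in admissible_sets #|skew|) [set F in family (index_range W)])) _.
  apply/subsetP => _ /imsetP[T T_S ->]; apply/bigcupP; exists (skew_ribbons T).
    exact: skew_ribbons_admissible.
  by rewrite inE; apply: ribbon_index_in_family.
apply: leq_trans (leq_card_bigcup _ _) _.
rewrite -sum_nat_const; apply: leq_sum => W W_adm.
rewrite cardsE card_family_index_range leq_mul2l.
by rewrite leq_expn2r ?orbT ?(card_admissible_le W_adm).
Qed.

End RibbonTableau.

Lemma card_lower_diagram n lam : is_partition n lam -> 0 < n ->
  #|lower_diagram n lam| = n - nth 0 lam 0.
Proof.
case/and3P => _ lam_gt0 /eqP sum_lam n_gt0.
have lam_le i : nth 0 lam i <= n by rewrite -sum_lam nth_le_sumn.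
have sum_ord : \sum_(i < n) nth 0 lam i = n.
  by rewrite sum_nth_ord // -sum_lam size_le_sumn.
have -> : lower_diagram n lam =
          [set c : cell n | (c.1 != 0 :> nat) && (c.2 < nth 0 lam c.1)].
  by apply/setP => c; rewrite !inE andbC.
rewrite (card_cells_lt n (nth 0 lam) (fun i => i != 0)).
rewrite -[in RHS]sum_ord [in RHS](bigD1 (Ordinal n_gt0)) //= addKn.
apply: eq_big => [i | i _]; last by rewrite (minn_idPl (lam_le i)).
by rewrite -(inj_eq val_inj).
Qed.

Lemma card_ribbons_len al i : i != 0 -> #|ribbons_len al i| = count_mem i al.
Proof.
move=> i_neq0.
transitivity #|[set x : 'I_(size al).+1 | (nth 0 al x == i) && true]|.
  by apply: eq_card => x; rewrite !inE andbT.
rewrite (card_nth_eq_widen _ (fun _ => true) i_neq0) -sum1dep_card.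
by rewrite -sum1_count (big_nth 0) big_mkord; apply: eq_bigl => j; rewrite andbT.
Qed.

Lemma count_cycle_type n (sigma : {perm 'I_n}) i :
  count_mem i (cycle_type_inc sigma) = fcyc sigma i.
Proof.
rewrite /cycle_type_inc count_sort count_map count_enum_card.
by apply: eq_card => c; rewrite !inE.
Qed.

Lemma card_S_set_cycle_type_le n lam (sigma : {perm 'I_n}) mu s :
  (forall i, #|lower_skew n lam mu| < i -> s i = 0) ->
  \sum_(2 <= i < #|lower_skew n lam mu|.+1) i * s i = #|lower_skew n lam mu| ->
  #|S_set n lam (cycle_type_inc sigma) mu s| <=
    (\prod_(i < #|lower_skew n lam mu|.+1 | 2 <= i) fcyc sigma i ^ s i) *
    (fcyc sigma 1 ^ (#|lower_diagram n lam| - #|lower_skew n lam mu|) *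
     #|lower_skew n lam mu| ^ #|lower_skew n lam mu|).
Proof.
move=> s_eq0 sum_s; apply: leq_trans (card_S_set_le _ s_eq0 sum_s) _.
rewrite (card_ribbons_len _ (isT : 1 != 0)) count_cycle_type.
have -> : #|lower_mu n lam mu| = #|lower_diagram n lam| - #|lower_skew n lam mu|.
  by rewrite lower_skewE -(cardsID (diagram n mu) (lower_diagram n lam)) addnK.
rewrite leq_mul2r; apply/orP; right.
apply: leq_trans (card_admissible_sets _ _ _) _; apply: leq_prod => i le_2i.
by rewrite card_ribbons_len ?count_cycle_type ?bin_le_expn // -lt0n ltnW.
Qed.

Local Open Scope ring_scope.

Lemma powR_invn_exprn (R : realType) (x : R) i : 0 <= x -> (0 < i)%N ->
  (x `^ (i%:R)^-1) ^+ i = x.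
Proof.
move=> x_ge0 i_gt0; rewrite -powR_mulrn ?powR_ge0 // -powRrM mulVf ?powRr1 //.
by rewrite pnatr_eq0 -lt0n.
Qed.

Section CycleStatistics.
Variables (R : realType) (n : nat) (sigma : {perm 'I_n}).

Lemma fcyc_root_le_bigmax m i : (m <= i <= n)%N ->
  (fcyc sigma i)%:R `^ (i%:R)^-1 <=
  \big[Num.max/0]_(m <= j < n.+1) (fcyc sigma j)%:R `^ (j%:R)^-1 :> R.
Proof.
move=> le_mi_n.
apply: (le_bigmax_seq _ _ _ (fun j => (fcyc sigma j)%:R `^ (j%:R)^-1)) => //.
by rewrite mem_index_iota ltnS.
Qed.

Lemma Gstat_ge0 : 0 <= Gstat R sigma.
Proof.
apply: (big_ind (fun x : R => 0 <= x)) => // [x y x_ge0 _ | i _]; last exact: powR_ge0.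
by rewrite le_max x_ge0.
Qed.

Lemma Gstat_le_Mstat : Gstat R sigma <= Mstat R sigma.
Proof. exact: le_bigmax_nat. Qed.

Lemma fcyc_le_GstatX i : (2 <= i <= n)%N -> (fcyc sigma i)%:R <= Gstat R sigma ^+ i.
Proof.
move=> /andP[le_2i le_in].
rewrite -(powR_invn_exprn (ler0n R (fcyc sigma i)) (ltnW le_2i)).
apply: lerXn2r; rewrite ?nnegrE ?powR_ge0 ?Gstat_ge0 //.
by rewrite /Gstat fcyc_root_le_bigmax ?le_2i.
Qed.

Lemma fcyc1_le_Mstat : (0 < n)%N -> (fcyc sigma 1)%:R <= Mstat R sigma.
Proof.
move=> n_gt0.
have -> : (fcyc sigma 1)%:R = (fcyc sigma 1)%:R `^ (1%:R)^-1 :> R by rewrite invr1 powRr1.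
by rewrite /Mstat fcyc_root_le_bigmax.
Qed.

Lemma prod_fcyc_le_GstatX K (s : nat -> nat) : (K <= n)%N ->
  (\sum_(2 <= i < K.+1) i * s i)%N = K ->
  \prod_(i < K.+1 | (2 <= i)%N) (fcyc sigma i)%:R ^+ s i <= Gstat R sigma ^+ K.
Proof.
move=> le_Kn sum_s.
apply: le_trans (_ : _ <= \prod_(i < K.+1 | (2 <= i)%N) Gstat R sigma ^+ (i * s i)) _.
  apply: ler_prod => i le_2i; rewrite exprn_ge0 ?ler0n //= exprM.
  apply: lerXn2r; rewrite ?nnegrE ?ler0n ?exprn_ge0 ?Gstat_ge0 //.
  by apply: fcyc_le_GstatX; rewrite le_2i; have := ltn_ord i; lia.
rewrite prodrXr (_ : \sum_(i < K.+1 | (2 <= i)%N) i * s i = K)%N //.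
by rewrite -[RHS]sum_s big_geq_mkord.
Qed.

End CycleStatistics.

Theorem lemma2p10 (R : realType) (r : nat) (hr : (1 <= r)%N) :
  exists C : R,
  forall (n : nat) (lam : seq nat) (sigma : {perm 'I_n}) (mu : seq nat)
         (s : nat -> nat),
    (3 * r <= n)%N ->
    is_partition n lam ->
    (n - nth 0 lam 0)%N = r ->
    (2 * r <= fcyc sigma 1)%N ->
    is_partition (fcyc sigma 1) mu ->
    subpart mu lam ->
    (2 <= #|lower_skew n lam mu|)%N ->
    (forall i, (#|lower_skew n lam mu| < i)%N -> s i = 0%N) ->
    (\sum_(2 <= i < #|lower_skew n lam mu|.+1) i * s i)%N = #|lower_skew n lam mu| ->
    let f := fcyc sigma 1 in
    let K := #|lower_skew n lam mu| in
    (#|S_set n lam (cycle_type_inc sigma) mu s|%:R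
       <= C * f%:R ^+ (r - K) * Gstat R sigma ^+ K)
    /\ (C * f%:R ^+ (r - K) * Gstat R sigma ^+ K <= C * Mstat R sigma ^+ r).
Proof.
exists (r ^ r)%N%:R.
move=> n lam sigma mu s le_3r_n lam_part lam_r _ _ _ _ s_eq0 sum_s f K.
have n_gt0 : (0 < n)%N by lia.
have card_lower : #|lower_diagram n lam| = r by rewrite card_lower_diagram.
have le_Kr : (K <= r)%N by rewrite /K -card_lower lower_skewE subset_leq_card ?subsetDl.
have G_ge0 := Gstat_ge0 R sigma.
split.
- have le_KK : (K ^ K <= r ^ r)%N.
    exact: leq_trans (leq_expn2r K le_Kr) (leq_pexp2l hr le_Kr).
  have := card_S_set_cycle_type_le sigma s_eq0 sum_s; rewrite -/K -/f card_lower.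
  move/leq_trans/(_ (leq_mul (leqnn _) (leq_mul (leqnn _) le_KK))).
  rewrite -(ler_nat R) natrM natr_prod natrM !natrX => /le_trans; apply.
  rewrite [X in _ <= X](_ : _ = Gstat R sigma ^+ K * (f%:R ^+ (r - K) * r%:R ^+ r));
    last by ring.
  apply: ler_wpM2r; first by rewrite mulr_ge0 ?exprn_ge0.
  under eq_bigr do rewrite natrX.
  by apply: prod_fcyc_le_GstatX => //; lia.
- have M_ge0 : 0 <= Mstat R sigma := le_trans G_ge0 (Gstat_le_Mstat R sigma).
  rewrite -!mulrA ler_wpM2l ?ler0n // -[in leRHS](subnK le_Kr) exprD.
  apply: ler_pM; rewrite ?exprn_ge0 ?ler0n //; apply: lerXn2r;
    by rewrite ?nnegrE ?ler0n ?(Gstat_le_Mstat R sigma) ?fcyc1_le_Mstat.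
Qed.
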